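(* Let $A\in\mathbb{M}_n(\mathbb{C})$ be a partial isometry with $k=\mathrm{ind}(A)$. If either (a) $A^k$ is Hermitian and a partial isometry, or (b) $A^{k+1}$ is Hermitian and a partial isometry, then $A$ is CEPD.
   Context: $\mathbb{M}_n(\mathbb{C})$ is the algebra of $n\times n$ complex matrices; $^*$ is conjugate transpose; $\mathcal{R}(\cdot)$ is column space; $A^0=I$. A matrix $B$ is a partial isometry if its Moore-Penrose inverse satisfies $B^\dagger=B^*$, equivalently $BB^*B=B$. The index $\mathrm{ind}(A)$ is the smallest integer $k\ge 0$ with $\mathrm{rank}(A^k)=\mathrm{rank}(A^{k+1})$. With $k=\mathrm{ind}(A)$, the Drazin inverse $A^D$ is the unique $X$ with $AX=XA$, $XAX=X$, $XA^{k+1}=A^k$. The core EP inverse of $A$, denoted here $A^{\mathrm{cep}}$, is the unique $X\in\mathbb{M}_n(\mathbb{C})$ with $XAX=X$ and $\mathcal{R}(X)=\mathcal{R}(A^k)=\mathcal{R}(X^* )$. $A$ is called core EP Drazin (CEPD) if $A^{\mathrm{cep}}A^D=A^DA^{\mathrm{cep}}$. *)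

(* Defs.v *)
From HB Require Import structures.
From mathcomp Require Import all_boot all_order all_algebra.
From mathcomp Require Export complex reals.

Set Implicit Arguments.
Unset Strict Implicit.
Unset Printing Implicit Defensive.

Import Order.TTheory GRing.Theory Num.Theory.
Local Open Scope ring_scope.
Local Open Scope sesquilinear_scope.

(* The definitions make sense over any numClosedFieldType C (over any fieldType
   for the index and the Drazin inverse); the complex field is the instance
   C := R[i] for R : realType.  M ^t* is the library's conjugate transpose, and
   'M[C]_n is a ring for every n, n = 0 included, so A ^+ 0 = 1%:M. *)

(* MathComp's %MS relations compare row spaces, hence the transpositions. *)
Definition eq_colspace (F : fieldType) (m n p : nat)
    (A : 'M[F]_(m, n)) (B : 'M[F]_(m, p)) : bool :=
  (A^T == B^T)%MS.

(* G is an inner inverse of M (M G M = M); each generalized inverse below is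
   obtained as a product B G B' from such a G. *)
Lemma ginvP (F : fieldType) (m n : nat) (M : 'M[F]_(m, n)) :
  exists G : 'M[F]_(n, m),
    (forall p (B : 'M[F]_(p, n)),
       \rank M = \rank B -> (M <= B)%MS -> B *m G *m M = B) /\
    (forall p (B : 'M[F]_(m, p)),
       \rank M = \rank B -> (M^T <= B^T)%MS -> M *m G *m B = B).
Proof.
exists (pinvmx M); split=> p B rkMB sMB.
  by apply: mulmxKpV; rewrite -(geq_leqif (mxrank_leqif_sup sMB)) rkMB.
have : (B^T <= M^T)%MS.
  by rewrite -(geq_leqif (mxrank_leqif_sup sMB)) !mxrank_tr rkMB.
case/submxP=> W /(congr1 trmx); rewrite trmxK trmx_mul trmxK => ->.
by rewrite mulmxA mulmxKpV.
Qed.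

Lemma trmxC_mul (C : numClosedFieldType) (m n p : nat) (A : 'M[C]_(m, n))
    (B : 'M[C]_(n, p)) : (A *m B)^t* = B^t* *m A^t*.
Proof. by rewrite trmx_mul map_mxM. Qed.

Lemma mxrank_trmxC (C : numClosedFieldType) (m n : nat) (A : 'M[C]_(m, n)) :
  \rank (A^t*) = \rank A.
Proof. by rewrite mxrank_map mxrank_tr. Qed.

Lemma mxrank_mul_trmxC (C : numClosedFieldType) (m n p : nat)
    (Y : 'M[C]_(p, n)) (B : 'M[C]_(n, m)) :
  (Y <= B^t*)%MS -> \rank (Y *m B) = \rank Y.
Proof.
move=> sYB; have /eqP := mxrank_mul_ker Y B.
suff -> : (Y :&: kermx B = 0)%MS by rewrite mxrank0 addn0 => /eqP.
apply/eqP; rewrite -submx0.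
have /orthomx1P/orthomx_disj <- : kermx B *m (B^t*)^t* = 0.
  by rewrite trmxCK mulmx_ker.
by rewrite capmxC capmxS.
Qed.

Lemma trmxC_mulI (C : numClosedFieldType) (m n p : nat) (B : 'M[C]_(m, n))
    (Z : 'M[C]_(n, p)) : B^t* *m (B *m Z) = 0 -> B *m Z = 0.
Proof.
move=> /(congr1 (fun M => M^t*)); rewrite trmxC_mul trmxCK => BZ0.
apply/eqP; rewrite -mxrank_eq0 -mxrank_trmxC -(@mxrank_mul_trmxC _ _ _ _ _ B).
  by rewrite BZ0 trmx0 map_mx0 mxrank0.
by rewrite trmxC_mul submxMl.
Qed.

Lemma trmxC_projl (C : numClosedFieldType) (n : nat) (P : 'M[C]_n) :
  P^t* *m P = P^t* -> P^t* = P.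
Proof.
by move=> e; rewrite -[in RHS](trmxCK P) -{2}e trmxC_mul trmxCK e.
Qed.

Lemma trmxC_projr (C : numClosedFieldType) (n : nat) (P : 'M[C]_n) :
  P *m P^t* = P^t* -> P^t* = P.
Proof.
by move=> e; rewrite -[in RHS](trmxCK P) -{2}e trmxC_mul trmxCK e.
Qed.

(* The four Penrose equations. *)
Definition is_moore_penrose (C : numClosedFieldType) (m n : nat)
    (A : 'M[C]_(m, n)) (X : 'M[C]_(n, m)) : bool :=
  [&& A *m X *m A == A, X *m A *m X == X,
      (A *m X)^t* == A *m X & (X *m A)^t* == X *m A].

Lemma moore_penrose_exists (C : numClosedFieldType) (m n : nat)
    (A : 'M[C]_(m, n)) : exists X, is_moore_penrose A X.
Proof.
pose M := A^t* *m A *m A^t*.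
have rkM : \rank M = \rank (A^t*).
  by rewrite !mxrank_mul_trmxC // trmxCK submxMl.
have [G [GL GR]] := ginvP M.
pose X := A^t* *m G *m A^t*.
have XAA : X *m A *m A^t* = A^t*.
  by rewrite -[RHS](GL _ _ rkM) ?submxMl // /X /M !mulmxA.
have AAX : A^t* *m A *m X = A^t*.
  rewrite -[RHS](GR _ _ rkM); first by rewrite /X /M !mulmxA.
  by rewrite /M -mulmxA trmx_mul submxMl.
have AXA : A *m X *m A = A.
  apply/eqP; rewrite -subr_eq0 -mulmxA -[X in _ - X]mulmx1 -mulmxBr.
  apply/eqP/trmxC_mulI; rewrite mulmxA mulmxBr mulmx1 mulmxA AAX.
  exact: subrr.
exists X; apply/and4P; split; first exact/eqP.
- by apply/eqP; rewrite {2}/X !mulmxA XAA.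
- apply/eqP/trmxC_projl.
  by rewrite trmxC_mul -mulmxA [A^t* *m _]mulmxA AAX.
- by apply/eqP/trmxC_projr; rewrite trmxC_mul mulmxA XAA.
Qed.

Lemma moore_penrose_unique (C : numClosedFieldType) (m n : nat)
    (A : 'M[C]_(m, n)) (X Y : 'M[C]_(n, m)) :
  is_moore_penrose A X -> is_moore_penrose A Y -> X = Y.
Proof.
case/and4P=> /eqP X1 /eqP X2 /eqP X3 /eqP X4.
case/and4P=> /eqP Y1 /eqP Y2 /eqP Y3 /eqP Y4.
have eA : A *m X = A *m Y.
  by rewrite -[LHS]X3 -{1}Y1 -mulmxA trmxC_mul X3 Y3 mulmxA X1.
have Ae : X *m A = Y *m A.
  by rewrite -[LHS]X4 -{1}Y1 -[A *m Y *m A]mulmxA mulmxA trmxC_mul X4 Y4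
    -mulmxA [A *m (X *m A)]mulmxA X1.
by rewrite -X2 -mulmxA eA mulmxA Ae Y2.
Qed.

Definition moore_penrose (C : numClosedFieldType) (m n : nat)
    (A : 'M[C]_(m, n)) : 'M[C]_(n, m) :=
  xchoose (moore_penrose_exists A).

Lemma moore_penroseP (C : numClosedFieldType) (m n : nat) (A : 'M[C]_(m, n)) :
  is_moore_penrose A (moore_penrose A).
Proof. exact: xchooseP. Qed.

Definition partial_isometry (C : numClosedFieldType) (m n : nat)
    (A : 'M[C]_(m, n)) : Prop :=
  moore_penrose A = A^t*.

Lemma index_exists (F : fieldType) (n : nat) (A : 'M[F]_n) :
  exists k, \rank (A ^+ k) == \rank (A ^+ k.+1).
Proof.
case: (boolP [exists k : 'I_n.+1, \rank (A ^+ k) == \rank (A ^+ k.+1)]).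
  by case/existsP=> k rk; exists k.
rewrite negb_exists => /forallP ne.
have : (\rank (A ^+ n.+1) + n.+1 <= n)%N; last by rewrite addnS ltnNge leq_addl.
suff H k : (k <= n.+1)%N -> (\rank (A ^+ k) + k <= n)%N by exact: H.
elim: k => [_|k IHk lekn]; first by rewrite addn0 rank_leq_row.
apply: leq_trans (IHk (ltnW lekn)); rewrite addnS -addSn leq_add2r.
rewrite ltn_neqAle eq_sym (ne (Ordinal lekn)) exprS; exact: mxrankM_maxr.
Qed.

Definition mxindex (F : fieldType) (n : nat) (A : 'M[F]_n) : nat :=
  ex_minn (index_exists A).

Lemma sub_exprmx (F : fieldType) (n : nat) (A : 'M[F]_n) (j : nat) :
  (A ^+ mxindex A <= A ^+ (mxindex A + j))%MS.
Proof.
rewrite /mxindex; case: ex_minnP => k /eqP rk _.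
have sk : (A ^+ k <= A ^+ k.+1)%MS.
  rewrite -(geq_leqif (mxrank_leqif_sup _)) ?rk // exprS; exact: submxMl.
elim: j => [|j IHj]; first by rewrite addn0.
apply: submx_trans IHj _; case/submxP: sk => W e.
have -> : A ^+ (k + j) = W *m A ^+ (k + j.+1).
  by rewrite addnS -addSn !exprD {1}e -[LHS]mulmxA.
exact: submxMl.
Qed.

Lemma rank_exprmx (F : fieldType) (n : nat) (A : 'M[F]_n) (j : nat) :
  \rank (A ^+ (mxindex A + j)) = \rank (A ^+ mxindex A).
Proof.
apply/eqP; rewrite eqn_leq (mxrankS (sub_exprmx A j)) andbT exprD.
exact: mxrankM_maxl.
Qed.

Definition is_drazin (F : fieldType) (n : nat) (A X : 'M[F]_n) : bool :=
  [&& A *m X == X *m A, X *m A *m X == X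
    & X *m A ^+ (mxindex A).+1 == A ^+ mxindex A].

Lemma drazin_exists (F : fieldType) (n : nat) (A : 'M[F]_n) :
  exists X, is_drazin A X.
Proof.
set k := mxindex A; pose M := A ^+ (k + k.+1).
have AS : A ^+ k.+1 = A *m A ^+ k by rewrite exprS.
have AkS : A ^+ k.+1 = A ^+ k *m A by rewrite exprSr.
have ME : M = A ^+ k *m A ^+ k.+1 by rewrite /M exprD.
have MEr : M = A ^+ k.+1 *m A ^+ k by rewrite /M addnC exprD.
have rkM : \rank M = \rank (A ^+ k) by exact: rank_exprmx.
have [G [GL GR]] := ginvP M.
pose X := A ^+ k *m G *m A ^+ k.
have XA : X *m A ^+ k.+1 = A ^+ k.
  by rewrite /X -mulmxA -ME GL // MEr submxMl.
have AX : A ^+ k.+1 *m X = A ^+ k.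
  rewrite /X !mulmxA -MEr GR // ME trmx_mul; exact: submxMl.
have XAk : X *m A *m A ^+ k = A ^+ k by rewrite -mulmxA -AS.
have AkX : A ^+ k *m (A *m X) = A ^+ k by rewrite mulmxA -AkS.
have AXE : A *m X = A ^+ k *m (A *m (G *m A ^+ k)).
  by rewrite mulmxA -AkS AS /X !mulmxA.
have XAE : X *m A = A ^+ k *m G *m A *m A ^+ k.
  by rewrite -[RHS]mulmxA -AS AkS /X !mulmxA.
exists X; apply/and3P; rewrite -/k; split; apply/eqP => //.
  transitivity (X *m A *m (A *m X)); first by rewrite AXE [RHS]mulmxA XAk.
  by rewrite XAE -[LHS]mulmxA AkX.
by rewrite {2}/X !mulmxA XAk.
Qed.

Lemma drazin_unique (F : fieldType) (n : nat) (A X Y : 'M[F]_n) :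
  is_drazin A X -> is_drazin A Y -> X = Y.
Proof.
set k := mxindex A.
have expand Z : is_drazin A Z ->
    [/\ Z * A * A ^+ k = A ^+ k, A ^+ k * (A * Z) = A ^+ k,
        Z = A ^+ k * Z ^+ k * Z & Z = Z * (Z ^+ k * A ^+ k)].
  case/and3P=> /eqP Zc /eqP Z2 /eqP Z1.
  have comm : GRing.comm A Z := Zc; have ZAZ : Z * A * Z = Z := Z2.
  have el j : (A * Z) ^+ j * Z = Z.
    by elim: j => [|j IHj]; rewrite ?expr0 ?mul1r // exprS -mulrA IHj comm.
  have er j : Z * (Z * A) ^+ j = Z.
    by elim: j => [|j IHj]; rewrite ?expr0 ?mulr1 // exprSr mulrA IHj -comm
      mulrA.
  split; first by rewrite -mulrA -exprS.
  - rewrite mulrA -exprSr -[RHS]Z1 -/k.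
    exact: commr_sym (commrX _ (commr_sym comm)).
  - by rewrite -exprMn_comm ?el.
  - by rewrite -exprMn_comm ?er //; apply: commr_sym.
move=> /expand[XAk AkX X1 X2] /expand[YAk AkY Y1 Y2].
transitivity (X * A * Y).
  by rewrite -[in RHS]mulrA {2}X2 -!mulrA AkY -X2.
by rewrite {1}Y1 !mulrA XAk -Y1.
Qed.

Definition drazin (F : fieldType) (n : nat) (A : 'M[F]_n) : 'M[F]_n :=
  xchoose (drazin_exists A).

Lemma drazinP (F : fieldType) (n : nat) (A : 'M[F]_n) :
  is_drazin A (drazin A).
Proof. exact: xchooseP. Qed.

Definition is_core_ep (C : numClosedFieldType) (n : nat)
    (A X : 'M[C]_n) : bool :=
  [&& X *m A *m X == X, eq_colspace X (A ^+ mxindex A)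
    & eq_colspace (A ^+ mxindex A) (X^t*)].

Lemma core_ep_exists (C : numClosedFieldType) (n : nat) (A : 'M[C]_n) :
  exists X, is_core_ep A X.
Proof.
rewrite /is_core_ep; set k := mxindex A; set B := A ^+ k.
have AB : A ^+ k.+1 = A *m B by rewrite exprS.
have BA : A ^+ k.+1 = B *m A by rewrite exprSr.
pose M := B^t* *m (A *m B).
have rkM : \rank M = \rank B.
  rewrite -mxrank_trmxC trmxC_mul trmxCK mxrank_mul_trmxC.
    by rewrite mxrank_trmxC -AB -addn1 rank_exprmx.
  by rewrite -AB BA trmxC_mul submxMl.
have [G [GL GR]] := ginvP M.
have sMB : B *m G *m M = B by rewrite GL // /M mulmxA submxMl.
have sBM : M *m G *m B^t* = B^t*.
  by rewrite GR ?mxrank_trmxC // trmx_mul submxMl.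
pose X := B *m G *m B^t*.
have XAB : X *m (A *m B) = B by rewrite /X -mulmxA.
have BAX : B^t* *m A *m X = B^t* by rewrite /X !mulmxA -[_ *m A *m B]mulmxA.
exists X; apply/and3P; split.
- by rewrite {2}/X !mulmxA -[X *m A *m B]mulmxA XAB.
- apply/andP; split; first by rewrite /X -mulmxA trmx_mul submxMl.
  by rewrite -{1}XAB trmx_mul submxMl.
- apply/andP; split.
    have e : X^t* *m (B^t* *m A)^t* = B by rewrite -trmxC_mul BAX trmxCK.
    by rewrite -{1}e trmx_mul submxMl.
  by rewrite /X !trmxC_mul trmxCK trmx_mul submxMl.
Qed.

Lemma core_ep_unique (C : numClosedFieldType) (n : nat) (A X Y : 'M[C]_n) :
  is_core_ep A X -> is_core_ep A Y -> X = Y.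
Proof.
have colsub (P Q : 'M[C]_n) : (P^T <= Q^T)%MS -> exists W, P = Q *m W.
  case/submxP=> W /(congr1 trmx); rewrite trmxK trmx_mul trmxK => ->.
  by exists W^T.
have absorb Z Z' : is_core_ep A Z -> is_core_ep A Z' ->
    Z *m A *m Z' = Z' /\ Z' *m A *m Z = Z'.
  case/and3P=> /eqP ZAZ /andP[_ sBZ] /andP[sBZC _].
  case/and3P=> _ /andP[sZ'B _] /andP[_ sZ'CB]; split.
    have [W ->] := colsub _ _ (submx_trans sZ'B sBZ).
    by rewrite mulmxA ZAZ.
  have [W e] := colsub _ _ (submx_trans sZ'CB sBZC).
  have -> : Z' = W^t* *m Z by rewrite -[Z']trmxCK e trmxC_mul trmxCK.
  by rewrite -!mulmxA [Z *m (A *m Z)]mulmxA ZAZ.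
by move=> hX hY; have [_ <-] := absorb _ _ hY hX; have [-> _] := absorb _ _ hX hY.
Qed.

Definition core_ep (C : numClosedFieldType) (n : nat) (A : 'M[C]_n) : 'M[C]_n :=
  xchoose (core_ep_exists A).

Lemma core_epP (C : numClosedFieldType) (n : nat) (A : 'M[C]_n) :
  is_core_ep A (core_ep A).
Proof. exact: xchooseP. Qed.

Definition cepd (C : numClosedFieldType) (n : nat) (A : 'M[C]_n) : Prop :=
  core_ep A *m drazin A = drazin A *m core_ep A.

(* Main.v *)
Require Import Defs.
From mathcomp Require Import all_boot all_order all_algebra.
From mathcomp Require Import complex reals.
Import Order.TTheory GRing.Theory Num.Theory.
Local Open Scope ring_scope.
Local Open Scope complex_scope.

(** Let [m >= k = ind A] and suppose that [A ^+ m] is Hermitian. Its kernel, which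
    is that of [A ^+ k], is then the orthogonal complement of its range
    R(A^k), so [A] is the orthogonal direct sum of an invertible and a
    nilpotent part. The Drazin inverse [X] therefore satisfies
    R(X) = R(A^k) = R(X^H): it coincides with the core EP inverse, and commutes
    with it. *)

Local Open Scope sesquilinear_scope.

Lemma colspace_subP (F : fieldType) (m n p : nat) (B : 'M[F]_(m, n))
    (M : 'M[F]_(m, p)) :
  reflect (exists W, B = M *m W) (B^T <= M^T)%MS.
Proof.
apply: (iffP submxP) => -[W e]; exists W^T; last by rewrite e trmx_mul.
by rewrite -[B]trmxK e trmx_mul trmxK.
Qed.

Lemma drazin_comm (F : fieldType) (n : nat) (A : 'M[F]_n) :
  GRing.comm A (drazin A).
Proof. by have /and3P[/eqP] := drazinP A. Qed.

Lemma drazin_mulK (F : fieldType) (n : nat) (A : 'M[F]_n) :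
  drazin A * A * drazin A = drazin A.
Proof. by have /and3P[_ /eqP] := drazinP A. Qed.

(** [A * drazin A] fixes [drazin A], hence so do its powers, which split because the two factors
    commute. *)
Lemma drazin_exprl (F : fieldType) (n : nat) (A : 'M[F]_n) (m : nat) :
  drazin A = A ^+ m * drazin A ^+ m.+1.
Proof.
rewrite exprSr mulrA -exprMn_comm; last exact: drazin_comm.
elim: m => [|m IHm]; first by rewrite expr0 mul1r.
by rewrite exprS -mulrA -IHm drazin_comm drazin_mulK.
Qed.

(** The adjoint of this form begins with [(A ^+ m)^t*], which bounds the range of
    [(drazin A)^t*]. *)
Lemma drazin_exprr (F : fieldType) (n : nat) (A : 'M[F]_n) (m : nat) :
  drazin A = drazin A ^+ m.+1 * A ^+ m.
Proof.
have c : GRing.comm (A ^+ m) (drazin A ^+ m.+1).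
  by apply: commrX; apply/commr_sym/commrX/commr_sym/drazin_comm.
by rewrite -c -drazin_exprl.
Qed.

Lemma expr_drazin (F : fieldType) (n : nat) (A : 'M[F]_n) (m : nat) :
  (mxindex A <= m)%N -> A ^+ m = A ^+ m.+1 * drazin A.
Proof.
move=> /subnK <-; rewrite -addnS !exprD -mulrA; congr (_ * _).
have /and3P[_ _ /eqP {1}<-] := drazinP A.
exact/commrX/commr_sym/drazin_comm.
Qed.

(** Used to pass from the index to the exponent at which the power is Hermitian. *)
Lemma expr_mxindex_drazin (F : fieldType) (n : nat) (A : 'M[F]_n) (j : nat) :
  A ^+ mxindex A = A ^+ (mxindex A + j) * drazin A ^+ j.
Proof.
elim: j => [|j IHj]; first by rewrite addn0 expr0 mulr1.
by rewrite exprS mulrA addnS -expr_drazin ?leq_addr.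
Qed.

Lemma core_ep_drazin (C : numClosedFieldType) (n : nat) (A : 'M[C]_n)
    (m : nat) :
  (mxindex A <= m)%N -> A ^+ m \is hermsymmx -> core_ep A = drazin A.
Proof.
move=> lekm /is_hermitianmxP; rewrite expr0 scale1r => hermA.
apply: core_ep_unique (core_epP A) _.
have trE (P Q : 'M[C]_n) : (P * Q)^t* = Q^t* * P^t* := trmxC_mul P Q.
apply/and3P; split; first exact/eqP/drazin_mulK.
- apply/andP; split; apply/colspace_subP.
    by exists (drazin A ^+ (mxindex A).+1); apply: drazin_exprl.
  exists (A ^+ (mxindex A).+1).
  by have /and3P[_ _ /eqP ->] := drazinP A.
- apply/andP; split; apply/colspace_subP.
    (* A^k = A^m X^(m-k), where A^m = (A^m)^H = (A^(m+1) X)^H = X^H (A^(m+1))^H. *)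
    exists ((A ^+ m.+1)^t* * drazin A ^+ (m - mxindex A)).
    rewrite [LHS](expr_mxindex_drazin _ _ A (m - mxindex A)) subnKC //.
    by rewrite {1}hermA {1}(expr_drazin _ _ A m) // trE -[LHS]mulrA.
  (* X^H = (X^(m+1) A^m)^H = A^m (X^(m+1))^H, and A^m = A^k A^(m-k). *)
  exists (A ^+ (m - mxindex A) * (drazin A ^+ m.+1)^t*).
  by rewrite {1}(drazin_exprr _ _ A m) trE -hermA -{1}(subnKC lekm) exprD -mulrA.
Qed.

Local Close Scope sesquilinear_scope.

Theorem theorem4p9 (R : realType) (n : nat) (A : 'M[R[i]]_n) (k : nat)
    (hA : partial_isometry A) (hk : k = mxindex A)
    (hab : (A ^+ k \is hermsymmx /\ partial_isometry (A ^+ k)) \/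
           (A ^+ k.+1 \is hermsymmx /\ partial_isometry (A ^+ k.+1))) :
  cepd A.
Proof.
(* Take m = k in case (a) and m = k + 1 in case (b); both sides become the square of [drazin A]. *)
by rewrite /cepd; case: hab => -[hermA _];
  rewrite (core_ep_drazin _ _ _ _ _ hermA) // hk.
Qed.
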